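(* Let $\mathbb{T}$ be a time scale, $a<b$ in $\mathbb{T}$, and let $p,q,f$ be continuous functions on $[a,b]_{\mathbb{T}}$. Consider $$x^{\Delta\Delta}(t)+p(t)x^{\Delta}(t)+q(t)x(t)=f(t),\quad t\in[a,b]_{\mathbb{T}}.\qquad( * )$$ Assume the dynamic Riccati equation $$z^{\Delta}(t)+p(t)z(t)-z(t)z^{\sigma}(t)=q(t),\quad t\in[a,b]_{\mathbb{T}},$$ has a particular solution $z$ with $1+\mu(t)(z^\sigma(t)-p(t))\neq0$ and $1-\mu(t)z(t)\neq0$ for all $t\in[a,b]_{\mathbb{T}}$, and that $$\sup_{t\in[a,b]_{\mathbb{T}}}|e_{(z^\sigma-p)}(t,a)|\int_a^t|e_{(z^\sigma-p)}(a,\sigma(s))|\,\Delta s<\infty$$ and $$\sup_{t\in[a,b]_{\mathbb{T}}}|e_{-z}(t,a)|\int_a^t|e_{-z}(a,\sigma(s))|\,\Delta s<\infty.$$ Then $( * )$ has Hyers–Ulam stability on $[a,b]_{\mathbb{T}}$: for every $\varepsilon>0$, whenever $y\in C^2_{rd}([a,b]_{\mathbb{T}})$ satisfies $|y^{\Delta\Delta}(t)+p(t)y^{\Delta}(t)+q(t)y(t)-f(t)|\le\varepsilon$ for all $t\in[a,b]_{\mathbb{T}}$, there exists a solution $u\in C^2_{rd}([a,b]_{\mathbb{T}})$ of $( * )$ such that $|y(t)-u(t)|\le K\varepsilon$ for all $t\in[a,b]_{\mathbb{T}}$, for some constant $K>0$.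
   Context: A time scale $\mathbb{T}$ is a nonempty closed subset of $\mathbb{R}$; $[a,b]_{\mathbb{T}}:=[a,b]\cap\mathbb{T}$. $\sigma(t)=\inf\{s\in\mathbb{T}:s>t\}$ is the forward jump operator, $\mu(t)=\sigma(t)-t$ the graininess, $f^\Delta$ the delta derivative, $f^\sigma=f\circ\sigma$, and $\int\cdots\Delta s$ the delta integral. $C^2_{rd}([a,b]_{\mathbb{T}})$ denotes functions twice delta differentiable with rd-continuous second delta derivative. For a regressive rd-continuous function $r$ (i.e. $1+\mu r\neq0$), $e_r(t,s)$ denotes the time-scale exponential function, the unique solution of $x^\Delta=r(t)x$, $x(s)=1$. *)

(* Defs.v *)
From Stdlib Require Import Reals Lra ClassicalEpsilon.
Open Scope R_scope.

Definition closedR (T : R -> Prop) : Prop :=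
  forall x, (forall eps, 0 < eps -> exists s, T s /\ Rabs (s - x) < eps) -> T x.

Definition inI (T : R -> Prop) (a b t : R) : Prop := T t /\ a <= t <= b.

Definition is_inf (E : R -> Prop) (m : R) : Prop :=
  (forall s, E s -> m <= s) /\ (forall m', (forall s, E s -> m' <= s) -> m' <= m).

(** forward jump operator sigma(t) = inf {s in T | s > t}, with inf of the
    empty set := t (i.e. sigma(max T) = max T, the standard convention). *)
Definition tsigma (T : R -> Prop) (t : R) : R :=
  epsilon (inhabits t) (fun m =>
    ((exists s, T s /\ t < s) /\ is_inf (fun s => T s /\ t < s) m)
    \/ (~ (exists s, T s /\ t < s) /\ m = t)).

Definition tmu (T : R -> Prop) (t : R) : R := tsigma T t - t.

(** f is delta differentiable at t with f^Delta(t) = l (Bohner--Peterson Def. 1.10) *)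
Definition delta_deriv (T : R -> Prop) (f : R -> R) (t l : R) : Prop :=
  forall eps, 0 < eps -> exists delta, 0 < delta /\
    forall s, T s -> Rabs (s - t) < delta ->
      Rabs (f (tsigma T t) - f s - l * (tsigma T t - s)) <= eps * Rabs (tsigma T t - s).

Definition cont_at_on (T : R -> Prop) (a b : R) (g : R -> R) (t : R) : Prop :=
  forall eps, 0 < eps -> exists delta, 0 < delta /\
    forall s, inI T a b s -> Rabs (s - t) < delta -> Rabs (g s - g t) < eps.

Definition cont_on (T : R -> Prop) (a b : R) (g : R -> R) : Prop :=
  forall t, inI T a b t -> cont_at_on T a b g t.

Definition left_dense (T : R -> Prop) (t : R) : Prop :=
  forall delta, 0 < delta -> exists s, T s /\ t - delta < s /\ s < t.

(** g rd-continuous on [a,b]_T: continuous at right-dense points, finite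
    left-sided limits at left-dense points (Bohner--Peterson Def. 1.58). *)
Definition rd_cont_on (T : R -> Prop) (a b : R) (g : R -> R) : Prop :=
  (forall t, inI T a b t -> tsigma T t = t -> cont_at_on T a b g t) /\
  (forall t, inI T a b t -> a < t -> left_dense T t ->
     exists L, forall eps, 0 < eps -> exists delta, 0 < delta /\
       forall s, inI T a b s -> t - delta < s -> s < t -> Rabs (g s - L) < eps).

Definition C2rd (T : R -> Prop) (a b : R) (y y1 y2 : R -> R) : Prop :=
  (forall t, inI T a b t -> delta_deriv T y t (y1 t)) /\
  (forall t, inI T a b t -> delta_deriv T y1 t (y2 t)) /\
  rd_cont_on T a b y2.

(** Delta integral  \int_a^t g(s) Delta s = I  (Cauchy integral via an
    antiderivative on [a,t]_T: G continuous on [a,t]_T, G^Delta = g on [a,t)_T). *)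
Definition delta_integral (T : R -> Prop) (g : R -> R) (a t I : R) : Prop :=
  exists G : R -> R,
    (forall s, T s -> a <= s -> s < t -> delta_deriv T G s (g s)) /\
    (forall s, inI T a t s -> cont_at_on T a t G s) /\
    I = G t - G a.

Definition exp_sol (T : R -> Prop) (a b : R) (r : R -> R) (s : R) (x : R -> R) : Prop :=
  x s = 1 /\ forall t, inI T a b t -> delta_deriv T x t (r t * x t).

(** time-scale exponential e_r(t,s) for t, s in [a,b]_T: the value at t of
    the (unique, for regressive r) solution of x^Delta = r x, x(s) = 1. *)
Definition texp (T : R -> Prop) (a b : R) (r : R -> R) (t s : R) : R :=
  epsilon (inhabits 0) (fun v => exists x, exp_sol T a b r s x /\ x t = v).

(* Main.v *)
(** On a compact interval of a time scale the initial value problem for a linear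
    second-order dynamic equation is solvable by Picard iteration: the unknown is
    [u^ΔΔ], and the map expressing it through its first and second delta primitives
    is a contraction of ratio 1/2 for the sup norm weighted by [exp (- lam (t - a))],
    [lam = 2 (sup |p| + sup |q|) + 1].  Take [u] with the same initial data as [y].
    The same contraction, applied to [w = y - u], turns [|w^ΔΔ + p w^Δ + q w| <= eps]
    into [|w| <= 2 eps exp (lam (t - a))]. *)

Require Import Defs.
From Stdlib Require Import Reals Lra Lia ClassicalEpsilon.
From Coquelicot Require Import Coquelicot.
Open Scope R_scope.

(** The set [T] is arbitrary, so gaps and accumulation points may alternate without any pattern. Two
    devices cope with this. Arguments along [[a,b]_T] go by induction on the time scale, which also
    stands in for compactness. Delta primitives are ordinary Riemann integrals of [g] composed with
    the map sending [x] to the last point of [[a,b]_T] at or below it. The weight is the real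
    exponential because [1 + x <= exp x] makes it grow at delta rate at least [lam] across jumps as
    well as along dense stretches, whatever the graininess. In [lam], with [P] and [Q] bounding
    [|p|] and [|q|], the term [2 (P + Q)] gives [(P + Q) / lam <= 1/2], and the summand 1 gives
    [lam >= 1], so that the bound obtained for the first primitive also serves for the second. *)

(** * Closed sets, the forward jump and induction on a time scale *)

Lemma closedR_sup (A : R -> Prop) (m : R) :
  closedR A -> is_lub A m -> A m.
Proof.
  intros HA [Hub Hl]. apply HA. intros eps He.
  destruct (classic (exists s, A s /\ m - eps < s)) as [[s [As Hs]]|H].
  - exists s. split; [exact As|]. specialize (Hub s As).
    apply Rabs_def1; lra.
  - exfalso. assert (m <= m - eps); [|lra].
    apply Hl. intros s As. destruct (Rle_dec s (m - eps)); [assumption|].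
    exfalso. apply H. exists s. split; [exact As|lra].
Qed.

Lemma exists_is_inf (E : R -> Prop) (c : R) :
  (exists s, E s) -> (forall s, E s -> c <= s) -> exists m, is_inf E m.
Proof.
  intros [s0 Hs0] Hc.
  destruct (completeness (fun x => E (- x))) as [m [Hub Hl]].
  - exists (- c). intros x Hx. apply Hc in Hx. lra.
  - exists (- s0). now rewrite Ropp_involutive.
  - exists (- m). split.
    + intros s Hs. specialize (Hub (- s)). simpl in Hub.
      rewrite Ropp_involutive in Hub. specialize (Hub Hs). lra.
    + intros m' Hm'. assert (m <= - m'); [|lra].
      apply Hl. intros x Hx. apply Hm' in Hx. lra.
Qed.

Lemma is_inf_approx (E : R -> Prop) (m eps : R) :
  is_inf E m -> 0 < eps -> exists s, E s /\ m <= s < m + eps.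
Proof.
  intros [Hlb Hg] He. apply NNPP. intro H.
  assert (m + eps <= m); [|lra].
  apply Hg. intros s Es. destruct (Rle_dec (m + eps) s); [assumption|].
  exfalso. apply H. exists s. specialize (Hlb s Es). split; [exact Es|lra].
Qed.

Lemma closedR_inf (A E : R -> Prop) (m : R) :
  closedR A -> (forall s, E s -> A s) -> is_inf E m -> A m.
Proof.
  intros HA HE Hm. apply HA. intros eps He.
  destruct (is_inf_approx E m eps Hm He) as [s [Es Hs]].
  exists s. split; [auto|apply Rabs_def1; lra].
Qed.

Lemma tsigma_spec (T : R -> Prop) (t : R) :
  ((exists s, T s /\ t < s) /\ is_inf (fun s => T s /\ t < s) (tsigma T t))
  \/ (~ (exists s, T s /\ t < s) /\ tsigma T t = t).
Proof.
  unfold tsigma. apply epsilon_spec.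
  destruct (classic (exists s, T s /\ t < s)) as [H|H].
  - destruct (exists_is_inf _ t H) as [m Hm]; [intros s Hs; lra|].
    exists m. now left.
  - exists t. now right.
Qed.

Lemma tsigma_ge (T : R -> Prop) (t : R) : t <= tsigma T t.
Proof.
  destruct (tsigma_spec T t) as [[_ [_ H]]|[_ H]]; [|lra].
  apply H. intros s Hs. lra.
Qed.

Lemma tsigma_le (T : R -> Prop) (t s : R) : T s -> t < s -> tsigma T t <= s.
Proof.
  intros Ts Hs. destruct (tsigma_spec T t) as [[_ [H _]]|[H _]].
  - now apply H.
  - exfalso. apply H. now exists s.
Qed.

Lemma closedR_inI (T : R -> Prop) (a b : R) : closedR T -> closedR (inI T a b).
Proof.
  intros HT x Hx. repeat split.
  - apply HT. intros eps He. destruct (Hx eps He) as [s [[Ts _] Hs]]. eauto.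
  - apply Rnot_lt_le. intro H. destruct (Hx (a - x)) as [s [[_ Is] Hs]]; [lra|].
    apply Rabs_def2 in Hs. lra.
  - apply Rnot_lt_le. intro H. destruct (Hx (x - b)) as [s [[_ Is] Hs]]; [lra|].
    apply Rabs_def2 in Hs. lra.
Qed.

(** Let [m] be the infimum of the failing points; it lies in [[a,b]_T] by closedness. If [P m]
    holds, failing points accumulate at [m] from the right, so [m] is right-dense and the third
    clause is violated. If [P m] fails, then either [m] is a limit from the left or it is the
    forward jump of a point where [P] holds. *)
Lemma time_scale_induction (T : R -> Prop) (a b : R) (P : R -> Prop) :
  closedR T -> inI T a b a -> P a ->
  (forall t, inI T a b t -> t < tsigma T t -> inI T a b (tsigma T t) ->
     P t -> P (tsigma T t)) ->
  (forall t, inI T a b t -> tsigma T t = t -> P t ->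
     exists delta, 0 < delta /\
       forall s, inI T a b s -> t < s < t + delta -> P s) ->
  (forall t, inI T a b t ->
     (forall delta, 0 < delta -> exists s, inI T a b s /\ t - delta < s < t) ->
     (forall s, inI T a b s -> s < t -> P s) -> P t) ->
  forall t, inI T a b t -> P t.
Proof.
  intros HT Ia Pa Hsc Hrd Hld t0 It0. apply NNPP. intro Nt0.
  destruct (exists_is_inf (fun t => inI T a b t /\ ~ P t) a) as [m Hm].
  { now exists t0. }
  { intros s [[_ Hs] _]. lra. }
  assert (Im : inI T a b m).
  { apply (closedR_inf _ (fun t => inI T a b t /\ ~ P t));
      [now apply closedR_inI|tauto|exact Hm]. }
  assert (Hbelow : forall s, inI T a b s -> s < m -> P s).
  { intros s Is Hs. apply NNPP. intro Ns.
    destruct Hm as [Hm _]. specialize (Hm s (conj Is Ns)). lra. }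
  destruct (classic (P m)) as [Pm|Nm].
  - assert (Hacc : forall eps, 0 < eps -> exists s, inI T a b s /\ ~ P s /\ m < s < m + eps).
    { intros eps He. destruct (is_inf_approx _ m eps Hm He) as [s [[Is Ns] Hs]].
      exists s. destruct (Req_dec s m) as [->|Hne]; [tauto|].
      split; [assumption|split; [assumption|lra]]. }
    assert (Hs : tsigma T m = m).
    { destruct (Req_dec (tsigma T m) m) as [|Hne]; [assumption|exfalso].
      pose proof (tsigma_ge T m).
      destruct (Hacc (tsigma T m - m)) as [s [[Ts _] [_ Hs]]]; [lra|].
      assert (tsigma T m <= s) by (apply tsigma_le; tauto). lra. }
    destruct (Hrd m Im Hs Pm) as [delta [Hd H]].
    destruct (Hacc delta Hd) as [s [Is [Ns Hs']]]. auto.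
  - destruct (classic (forall delta, 0 < delta -> exists s, inI T a b s /\ m - delta < s < m))
      as [Hdense|Hn]; [now apply Nm, Hld|].
    assert (Ham : a < m).
    { destruct (Req_dec a m) as [<-|Hne]; [contradiction|]. destruct Im. lra. }
    apply not_all_ex_not in Hn. destruct Hn as [delta Hn].
    apply imply_to_and in Hn. destruct Hn as [Hd Hn].
    assert (Hgap : forall s, inI T a b s -> s < m -> s <= m - delta).
    { intros s Is Hs. apply Rnot_lt_le. intro. apply Hn. now exists s. }
    (* [r] is the last point of [[a,b]_T] before the gap below [m], so its forward jump lands on
       [m]. *)
    destruct (completeness (fun s => inI T a b s /\ s <= m - delta)) as [r Hr].
    { exists m. intros s Hs. lra. }
    { exists a. auto. }
    assert (Ir : inI T a b r /\ r <= m - delta).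
    { apply (closedR_sup (fun s => inI T a b s /\ s <= m - delta)); [|exact Hr].
      intros x Hx. split.
      - apply closedR_inI; [assumption|]. intros eps He.
        destruct (Hx eps He) as [s [[Is _] Hs]]. eauto.
      - apply Rnot_lt_le. intro H. destruct (Hx (x - (m - delta))) as [s [[_ Is] Hs]]; [lra|].
        apply Rabs_def2 in Hs. lra. }
    destruct Ir as [Ir Hrm].
    assert (Hsig : tsigma T r = m).
    { apply Rle_antisym.
      - apply tsigma_le; [apply Im|lra].
      - destruct (tsigma_spec T r) as [[_ [_ H]]|[H _]].
        + apply H. intros s [Ts Hs]. apply Rnot_lt_le. intro Hsm.
          assert (Is : inI T a b s).
          { destruct Ir as [_ Ir], Im as [_ Im]. split; [assumption|lra]. }
          destruct Hr as [Hr _].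
          specialize (Hr s (conj Is (Hgap s Is Hsm))). lra.
        + exfalso. apply H. exists m. split; [apply Im|lra]. }
    apply Nm. rewrite <- Hsig. apply Hsc; rewrite ?Hsig; try assumption; [lra|].
    apply Hbelow; [assumption|lra].
Qed.

(** * Calculus of the delta derivative *)

(** The choice [s = t] is allowed in the definition for every tolerance, so the error must vanish.
    The division by [m + 1] instead of [m] covers right-dense [t] as well. *)
Lemma delta_deriv_right_scattered (T : R -> Prop) (g : R -> R) (t l : R) :
  T t -> delta_deriv T g t l -> g (tsigma T t) = g t + l * (tsigma T t - t).
Proof.
  intros Tt Hg. apply cond_eq. intros eps He.
  set (m := Rabs (tsigma T t - t)).
  assert (Hm : 0 <= m) by apply Rabs_pos.
  destruct (Hg (eps / (m + 1))) as [d [Hd H]].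
  { apply Rdiv_lt_0_compat; lra. }
  specialize (H t Tt). replace (t - t) with 0 in H by ring.
  rewrite Rabs_R0 in H. specialize (H Hd). fold m in H.
  replace (g (tsigma T t) - (g t + l * (tsigma T t - t)))
    with (g (tsigma T t) - g t - l * (tsigma T t - t)) by ring.
  eapply Rle_lt_trans; [exact H|].
  apply (Rmult_lt_reg_r (m + 1)); [lra|].
  replace (eps / (m + 1) * m * (m + 1)) with (eps * m) by (field; lra).
  apply Rmult_lt_compat_l; lra.
Qed.

(** Once [g (tsigma T t)] is expressed through [g t], the definition controls
    [g s - g t - l (s - t)]. For [|s - t| < 1] one has [|tsigma T t - s| <= m + 1], so this error
    costs at most [eps / 2], and [l (s - t)] takes the other half. *)
Lemma delta_deriv_cont (T : R -> Prop) (g : R -> R) (t l : R) :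
  T t -> delta_deriv T g t l ->
  forall eps, 0 < eps -> exists delta, 0 < delta /\
    forall s, T s -> Rabs (s - t) < delta -> Rabs (g s - g t) < eps.
Proof.
  intros Tt Hg eps He.
  pose proof (delta_deriv_right_scattered T g t l Tt Hg) as Hs.
  pose proof (tsigma_ge T t) as Hm. set (m := tsigma T t - t).
  assert (Hm0 : 0 <= m) by (unfold m; lra).
  set (L := Rabs l). assert (HL : 0 <= L) by apply Rabs_pos.
  destruct (Hg (eps / (2 * (m + 1)))) as [d [Hd H]].
  { apply Rdiv_lt_0_compat; lra. }
  set (k := eps / (2 * (L + 1))).
  assert (Hk : 0 < k) by (apply Rdiv_lt_0_compat; lra).
  exists (Rmin (Rmin d 1) k). split; [repeat apply Rmin_pos; lra|].
  intros s Ts Hst.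
  assert (Hs1 : Rabs (s - t) < d) by (eapply Rlt_le_trans; [exact Hst|];
    eapply Rle_trans; [apply Rmin_l|apply Rmin_l]).
  assert (Hs2 : Rabs (s - t) < 1) by (eapply Rlt_le_trans; [exact Hst|];
    eapply Rle_trans; [apply Rmin_l|apply Rmin_r]).
  assert (Hs3 : Rabs (s - t) < k) by (eapply Rlt_le_trans; [exact Hst|apply Rmin_r]).
  specialize (H s Ts Hs1). rewrite Hs in H.
  assert (Ha : Rabs (tsigma T t - s) <= m + 1).
  { replace (tsigma T t - s) with (m - (s - t)) by (unfold m; ring).
    eapply Rle_trans; [apply Rabs_triang|].
    rewrite Rabs_Ropp, (Rabs_pos_eq m) by assumption. lra. }
  replace (g t + l * (tsigma T t - t) - g s - l * (tsigma T t - s))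
    with (- ((g s - g t) - l * (s - t))) in H by ring.
  rewrite Rabs_Ropp in H.
  assert (H1 : eps / (2 * (m + 1)) * Rabs (tsigma T t - s) <= eps / 2).
  { replace (eps / 2) with (eps / (2 * (m + 1)) * (m + 1)) by (field; lra).
    apply Rmult_le_compat_l; [|assumption].
    left. apply Rdiv_lt_0_compat; lra. }
  assert (H2 : Rabs (l * (s - t)) < eps / 2).
  { rewrite Rabs_mult. fold L. apply Rle_lt_trans with (L * k).
    - apply Rmult_le_compat_l; lra.
    - unfold k. apply (Rmult_lt_reg_r (2 * (L + 1))); [lra|].
      replace (L * (eps / (2 * (L + 1))) * (2 * (L + 1))) with (L * eps) by (field; lra).
      nra. }
  replace (g s - g t) with ((g s - g t - l * (s - t)) + l * (s - t)) by ring.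
  eapply Rle_lt_trans; [apply Rabs_triang|]. lra.
Qed.

Lemma delta_deriv_cont_on (T : R -> Prop) (a b : R) (g g1 : R -> R) :
  (forall t, inI T a b t -> delta_deriv T g t (g1 t)) -> cont_on T a b g.
Proof.
  intros Hg t It eps He.
  destruct (delta_deriv_cont T g t (g1 t) (proj1 It) (Hg t It) eps He) as [d [Hd H]].
  exists d. split; [assumption|]. intros s [Ts _]. auto.
Qed.

Lemma delta_deriv_lincomb (T : R -> Prop) (g h : R -> R) (t l k c : R) :
  delta_deriv T g t l -> delta_deriv T h t k ->
  delta_deriv T (fun s => g s + c * h s) t (l + c * k).
Proof.
  intros Hg Hh eps He. set (C := Rabs c). assert (HC : 0 <= C) by apply Rabs_pos.
  destruct (Hg (eps / 2)) as [d1 [Hd1 H1]]; [lra|].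
  destruct (Hh (eps / (2 * (C + 1)))) as [d2 [Hd2 H2]]; [apply Rdiv_lt_0_compat; lra|].
  exists (Rmin d1 d2). split; [now apply Rmin_pos|]. intros s Ts Hs.
  specialize (H1 s Ts (Rlt_le_trans _ _ _ Hs (Rmin_l _ _))).
  specialize (H2 s Ts (Rlt_le_trans _ _ _ Hs (Rmin_r _ _))).
  set (r := tsigma T t) in *.
  replace (g r + c * h r - (g s + c * h s) - (l + c * k) * (r - s))
    with ((g r - g s - l * (r - s)) + c * (h r - h s - k * (r - s))) by ring.
  eapply Rle_trans; [apply Rabs_triang|]. rewrite Rabs_mult. fold C.
  assert (Hr : 0 <= Rabs (r - s)) by apply Rabs_pos.
  assert (C * Rabs (h r - h s - k * (r - s)) <= eps / 2 * Rabs (r - s)); [|lra].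
  apply Rle_trans with (C * (eps / (2 * (C + 1)) * Rabs (r - s))).
  - now apply Rmult_le_compat_l.
  - rewrite <- Rmult_assoc. apply Rmult_le_compat_r; [assumption|].
    apply (Rmult_le_reg_r (2 * (C + 1))); [lra|].
    replace (C * (eps / (2 * (C + 1))) * (2 * (C + 1))) with (C * eps) by (field; lra).
    nra.
Qed.

Lemma delta_deriv_const (T : R -> Prop) (c t : R) : delta_deriv T (fun _ => c) t 0.
Proof.
  intros eps He. exists 1. split; [lra|]. intros s _ _.
  replace (c - c - 0 * (tsigma T t - s)) with 0 by ring.
  rewrite Rabs_R0. apply Rmult_le_pos; [lra|apply Rabs_pos].
Qed.

Lemma delta_deriv_ext (T : R -> Prop) (g h : R -> R) (t l k : R) :
  (forall s, g s = h s) -> l = k -> delta_deriv T g t l -> delta_deriv T h t k.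
Proof.
  intros E <- H eps He. destruct (H eps He) as [d [Hd K]].
  exists d. split; [assumption|]. intros s Ts Hs. rewrite <- !E. auto.
Qed.

Lemma delta_deriv_minus (T : R -> Prop) (g h : R -> R) (t l k : R) :
  delta_deriv T g t l -> delta_deriv T h t k ->
  delta_deriv T (fun s => g s - h s) t (l - k).
Proof.
  intros Hg Hh. eapply delta_deriv_ext; [| |apply (delta_deriv_lincomb T g h t l k (-1) Hg Hh)].
  - intro s. simpl. ring.
  - ring.
Qed.

(** Induction on [t] for boundedness on [[a,t]_T]: a jump adds one value, and near a dense point
    continuity adds values within 1 of [g t]. *)
Lemma cont_on_bounded (T : R -> Prop) (a b : R) (g : R -> R) :
  closedR T -> inI T a b a -> inI T a b b -> cont_on T a b g ->
  exists M, 0 <= M /\ forall t, inI T a b t -> Rabs (g t) <= M.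
Proof.
  intros HT Ia Ib Hg.
  destruct (time_scale_induction T a b
    (fun t => exists M, 0 <= M /\ forall s, inI T a b s -> s <= t -> Rabs (g s) <= M)
    HT Ia) with (t := b) as [M [HM H]]; [| | | |assumption|].
  - exists (Rabs (g a)). split; [apply Rabs_pos|]. intros s [_ Hs] Hsa.
    replace s with a by lra. lra.
  - intros t It Ht Is [M [HM H]]. exists (Rmax M (Rabs (g (tsigma T t)))).
    split; [eapply Rle_trans; [exact HM|apply Rmax_l]|].
    intros s Is' Hs. destruct (Rle_dec s t) as [Hst|Hst].
    + eapply Rle_trans; [now apply H|apply Rmax_l].
    + assert (tsigma T t <= s) by (apply tsigma_le; [apply Is'|lra]).
      replace s with (tsigma T t) by lra. apply Rmax_r.
  - intros t It Ht [M [HM H]]. destruct (Hg t It 1 Rlt_0_1) as [d [Hd Hc]].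
    exists d. split; [assumption|]. intros s Is Hs.
    assert (0 <= Rabs (g t)) by apply Rabs_pos.
    exists (M + Rabs (g t) + 1). split; [lra|].
    intros r Ir Hr. destruct (Rle_dec r t) as [Hrt|Hrt].
    + specialize (H r Ir Hrt). lra.
    + assert (Hrr : Rabs (g r - g t) < 1) by (apply Hc; [assumption|apply Rabs_def1; lra]).
      pose proof (Rabs_triang_inv (g r) (g t)). lra.
  - intros t It Hd0 H. destruct (Hg t It 1 Rlt_0_1) as [d [Hd Hc]].
    destruct (Hd0 d Hd) as [s [Is Hs]].
    destruct (H s Is (proj2 Hs)) as [M [HM HM']].
    assert (0 <= Rabs (g t)) by apply Rabs_pos.
    exists (M + Rabs (g t) + 1). split; [lra|].
    intros r Ir Hr. destruct (Rle_dec r s) as [Hrt|Hrt].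
    + specialize (HM' r Ir Hrt). lra.
    + assert (Hrr : Rabs (g r - g t) < 1) by (apply Hc; [assumption|apply Rabs_def1; lra]).
      pose proof (Rabs_triang_inv (g r) (g t)). lra.
  - exists M. split; [assumption|]. intros t It. apply H; [assumption|apply It].
Qed.

(** * The exponential weight and growth estimates *)

Definition weight (lam a t : R) : R := exp (lam * (t - a)).

(** This is [1 + x <= exp x]. It says that the weight is a supersolution of [w^Δ = lam w], in a form
    that holds for steps of any size. *)
Lemma weight_step (lam a s t : R) :
  weight lam a s * (1 + lam * (t - s)) <= weight lam a t.
Proof.
  unfold weight. replace (lam * (t - a)) with (lam * (s - a) + lam * (t - s)) by ring.
  rewrite exp_plus. apply Rmult_le_compat_l; [left; apply exp_pos|].
  destruct (Req_dec (lam * (t - s)) 0) as [->|Hne].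
  - rewrite exp_0. lra.
  - left. now apply exp_ineq1.
Qed.

Lemma weight_pos (lam a t : R) : 0 < weight lam a t.
Proof. apply exp_pos. Qed.

Lemma weight_le (lam a s t : R) : 0 <= lam -> s <= t -> weight lam a s <= weight lam a t.
Proof.
  intros Hl Hs. pose proof (weight_step lam a s t). pose proof (weight_pos lam a s).
  assert (0 <= weight lam a s * (lam * (t - s))); [|lra].
  apply Rmult_le_pos; [lra|]. apply Rmult_le_pos; lra.
Qed.

Lemma weight_ge_1 (lam a t : R) : 0 <= lam -> a <= t -> 1 <= weight lam a t.
Proof.
  intros Hl Ht. replace 1 with (weight lam a a); [now apply weight_le|].
  unfold weight. rewrite Rminus_diag, Rmult_0_r. apply exp_0.
Qed.

(** The function [N / lam * weight] grows at delta rate at least [N * weight], hence dominates [F].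
    At a right-dense point the derivative bounds [F] only up to an error [eta (s - t)]; the slack
    [eta (t - a)] absorbs it and is removed at the end. *)
Lemma delta_growth_upper (T : R -> Prop) (a b lam N : R) (F F1 : R -> R) :
  closedR T -> inI T a b a -> 0 < lam -> 0 <= N -> F a = 0 ->
  (forall t, inI T a b t -> delta_deriv T F t (F1 t)) ->
  (forall t, inI T a b t -> F1 t <= N * weight lam a t) ->
  forall t, inI T a b t -> F t <= N / lam * weight lam a t.
Proof.
  intros HT Ia Hl HN Fa HF HF1 t0 It0.
  assert (HNl : 0 <= N / lam) by (apply Rdiv_le_0_compat; lra).
  assert (Main : forall eta, 0 < eta -> forall t, inI T a b t ->
    F t <= N / lam * weight lam a t + eta * (t - a)).
  { intros eta He.
    (* One forward step, used both for a jump and for a short move from a right-dense point. *)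
    assert (Hstep : forall t s, inI T a b t -> t <= s ->
      F t <= N / lam * weight lam a t + eta * (t - a) ->
      F s <= F t + (F1 t + eta) * (s - t) ->
      F s <= N / lam * weight lam a s + eta * (s - a)).
    { intros t s It Hts Ht Hs. specialize (HF1 t It).
      assert (H1 : F1 t * (s - t) <= N * weight lam a t * (s - t))
        by (apply Rmult_le_compat_r; lra).
      assert (H2 : N / lam * (weight lam a t * (1 + lam * (s - t)))
        <= N / lam * weight lam a s)
        by (apply Rmult_le_compat_l; [assumption|apply weight_step]).
      replace (N / lam * (weight lam a t * (1 + lam * (s - t))))
        with (N / lam * weight lam a t + N * weight lam a t * (s - t)) in H2 by (field; lra).
      lra. }
    apply (time_scale_induction T a b _ HT Ia).
    - rewrite Fa. pose proof (weight_pos lam a a).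
      assert (0 <= N / lam * weight lam a a) by (apply Rmult_le_pos; lra). lra.
    - intros t It Ht _ Pt. apply (Hstep t); try assumption; [lra|].
      rewrite (delta_deriv_right_scattered T F t (F1 t) (proj1 It) (HF t It)).
      assert (0 <= eta * (tsigma T t - t)) by (apply Rmult_le_pos; lra). lra.
    - intros t It Ht Pt. destruct (HF t It eta He) as [d [Hd H]].
      exists d. split; [assumption|]. intros s Is Hs.
      apply (Hstep t); try assumption; [lra|].
      assert (Hst : Rabs (s - t) < d) by (apply Rabs_def1; lra).
      specialize (H s (proj1 Is) Hst). rewrite Ht in H.
      rewrite (Rabs_left1 (t - s)) in H by lra.
      apply Rabs_le_between in H. lra.
    (* The bound is nondecreasing, so if [F t] exceeded it, continuity would make [F] exceed it at
       some earlier point too. *)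
    - intros t It Hdense H. apply Rnot_lt_le. intro Hlt.
      set (B := N / lam * weight lam a t + eta * (t - a)) in *.
      destruct (delta_deriv_cont_on T a b F F1 HF t It (F t - B)) as [d [Hd Hc]]; [lra|].
      destruct (Hdense d Hd) as [s [Is Hs]].
      specialize (H s Is (proj2 Hs)).
      assert (Hst : Rabs (s - t) < d) by (apply Rabs_def1; lra).
      specialize (Hc s Is Hst). apply Rabs_def2 in Hc.
      assert (N / lam * weight lam a s <= N / lam * weight lam a t)
        by (apply Rmult_le_compat_l; [assumption|apply weight_le; lra]).
      assert (eta * (s - a) <= eta * (t - a)) by (apply Rmult_le_compat_l; lra).
      unfold B in *. lra. }
  apply le_epsilon. intros eps He.
  destruct It0 as [Tt Ht].
  assert (Hk : 0 < eps / (t0 - a + 1)) by (apply Rdiv_lt_0_compat; lra).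
  specialize (Main _ Hk t0 (conj Tt Ht)).
  assert (eps / (t0 - a + 1) * (t0 - a) <= eps); [|lra].
  apply (Rmult_le_reg_r (t0 - a + 1)); [lra|].
  replace (eps / (t0 - a + 1) * (t0 - a) * (t0 - a + 1)) with (eps * (t0 - a)) by (field; lra).
  nra.
Qed.

Lemma delta_growth (T : R -> Prop) (a b lam N : R) (F F1 : R -> R) :
  closedR T -> inI T a b a -> 0 < lam -> 0 <= N -> F a = 0 ->
  (forall t, inI T a b t -> delta_deriv T F t (F1 t)) ->
  (forall t, inI T a b t -> Rabs (F1 t) <= N * weight lam a t) ->
  forall t, inI T a b t -> Rabs (F t) <= N / lam * weight lam a t.
Proof.
  intros HT Ia Hl HN Fa HF HF1 t It. apply Rabs_le_between. split.
  - assert (0 - F t <= N / lam * weight lam a t); [|lra].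
    apply (delta_growth_upper T a b lam N (fun s => 0 - F s) (fun s => 0 - F1 s));
      try assumption.
    + lra.
    + intros s Is. apply delta_deriv_minus; [apply delta_deriv_const|auto].
    + intros s Is. specialize (HF1 s Is). apply Rabs_le_between in HF1. lra.
  - apply (delta_growth_upper T a b lam N F F1); try assumption.
    intros s Is. specialize (HF1 s Is). apply Rabs_le_between in HF1. lra.
Qed.

(** * Delta primitives as Riemann integrals *)

(** The graph of [fun x => g (tfloor T a b x)] is constant on the gaps
    of [T], so its Riemann integral is the delta integral of [g]. *)
Definition tfloor (T : R -> Prop) (a b x : R) : R :=
  epsilon (inhabits a) (is_lub (fun s => inI T a b s /\ s <= Rmax a x)).

(** The cut-off [Rmax a x] keeps the set nonempty for [x < a], where [tfloor] then equals [a].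
    Closedness makes the supremum a maximum. *)
Lemma tfloor_spec (T : R -> Prop) (a b x : R) :
  closedR T -> inI T a b a ->
  inI T a b (tfloor T a b x) /\ tfloor T a b x <= Rmax a x /\
  forall s, inI T a b s -> s <= Rmax a x -> s <= tfloor T a b x.
Proof.
  intros HT Ia.
  assert (H : is_lub (fun s => inI T a b s /\ s <= Rmax a x) (tfloor T a b x)).
  { unfold tfloor. apply epsilon_spec.
    destruct (completeness (fun s => inI T a b s /\ s <= Rmax a x)) as [m Hm].
    - exists (Rmax a x). intros s Hs. tauto.
    - exists a. split; [assumption|apply Rmax_l].
    - now exists m. }
  assert (HA : closedR (fun s => inI T a b s /\ s <= Rmax a x)).
  { intros y Hy. split.
    - apply closedR_inI; [assumption|]. intros eps He.
      destruct (Hy eps He) as [s [[Is _] Hs]]. eauto.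
    - apply Rnot_lt_le. intro Hlt.
      destruct (Hy (y - Rmax a x)) as [s [[_ Is] Hs]]; [lra|].
      apply Rabs_def2 in Hs. lra. }
  destruct (closedR_sup _ _ HA H) as [H1 H2].
  split; [assumption|]. split; [assumption|].
  intros s Is Hs. now apply (proj1 H).
Qed.

(** [tfloor] never takes a value strictly between [t] and [tsigma T t]. So between [s] and
    [tsigma T t] the integrand only sees points as close to [t] as [s] is, however long the jump. *)
Lemma tfloor_near (T : R -> Prop) (a b s t x : R) :
  closedR T -> inI T a b a -> inI T a b t -> T s ->
  Rmin s (tsigma T t) < x < Rmax s (tsigma T t) ->
  Rabs (tfloor T a b x - t) <= Rabs (s - t).
Proof.
  intros HT Ia It Ts Hx.
  destruct (tfloor_spec T a b x HT Ia) as [If [Hf Hmax]].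
  set (r := tfloor T a b x) in *. pose proof (tsigma_ge T t) as Hsig.
  destruct It as [Tt It].
  destruct (Rle_dec s t) as [Hst|Hst].
  - rewrite Rmin_left, Rmax_right in Hx by lra.
    rewrite (Rabs_left1 (s - t)) by lra.
    assert (Hrt : r <= t).
    { apply Rnot_lt_le. intro Hlt.
      assert (tsigma T t <= r) by (apply tsigma_le; [apply If|assumption]).
      destruct (Rle_dec a x); [rewrite Rmax_right in Hf by lra|rewrite Rmax_left in Hf by lra]; lra. }
    rewrite Rabs_left1 by lra. assert (s <= r); [|lra].
    destruct (Rle_dec a s) as [Has|Has].
    + apply Hmax; [split; [assumption|lra]|].
      apply Rle_trans with x; [lra|apply Rmax_r].
    + destruct If. lra.
  - assert (tsigma T t <= s) by (apply tsigma_le; [assumption|lra]).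
    rewrite Rmin_right, Rmax_left in Hx by lra.
    assert (t <= r).
    { apply Hmax; [split; assumption|]. apply Rle_trans with x; [lra|apply Rmax_r]. }
    rewrite Rmax_right in Hf by lra.
    rewrite !Rabs_pos_eq; lra.
Qed.

Lemma ex_RInt_uniform_approx (g : R -> R) (a b : R) :
  a <= b ->
  (forall eps, 0 < eps -> exists h, ex_RInt h a b /\
     forall x, a < x < b -> Rabs (h x - g x) <= eps) ->
  ex_RInt g a b.
Proof.
  intros Hab H.
  assert (H' : forall n : nat, exists h, ex_RInt h a b /\
    forall x, Rabs (h x - g x) <= / (INR n + 1)).
  { intro n. assert (Hn : 0 < / (INR n + 1))
      by (apply Rinv_0_lt_compat; pose proof (pos_INR n); lra).
    destruct (H _ Hn) as [h [Hi Hh]].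
    (* [filterlim_RInt] asks for uniform convergence on the whole line, so the approximant is
       replaced by [g] off the open interval, which does not affect integrability over it. *)
    exists (fun x => if Rlt_dec a x then if Rlt_dec x b then h x else g x else g x).
    split.
    - apply (ex_RInt_ext h); [|assumption]. intros x Hx.
      rewrite Rmin_left, Rmax_right in Hx by assumption.
      destruct (Rlt_dec a x); [|lra]. destruct (Rlt_dec x b); [reflexivity|lra].
    - intro x. assert (Hz : Rabs (g x - g x) <= / (INR n + 1))
        by (rewrite Rminus_diag; rewrite Rabs_R0; lra).
      destruct (Rlt_dec a x); [|assumption]. destruct (Rlt_dec x b); [|assumption].
      apply Hh. lra. }
  set (h := fun n => epsilon (inhabits g) (fun h => ex_RInt h a b /\
    forall x, Rabs (h x - g x) <= / (INR n + 1))).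
  assert (Hh : forall n, ex_RInt (h n) a b /\ forall x, Rabs (h n x - g x) <= / (INR n + 1)).
  { intro n. unfold h. apply epsilon_spec, H'. }
  destruct (filterlim_RInt h a b eventually _ g (fun n => RInt (h n) a b)) as [I [_ HI]].
  - intro n. apply RInt_correct, Hh.
  - apply filterlim_locally. intro eps.
    destruct (archimed_cor1 eps (cond_pos eps)) as [N [HN HN0]].
    exists N. intros n Hn x. apply Rle_lt_trans with (/ (INR n + 1)).
    + apply (proj2 (Hh n) x).
    + apply Rle_lt_trans with (/ INR N); [|assumption].
      apply Rinv_le_contravar; [now apply lt_0_INR|].
      apply le_INR in Hn. lra.
  - now exists I.
Qed.

(** The integrand may jump at infinitely many points, so it is obtained as a uniform limit. For
    fixed [eps], induction on the time scale builds an approximant out of constant pieces. *)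
Lemma ex_RInt_tfloor (T : R -> Prop) (a b : R) (g : R -> R) :
  closedR T -> inI T a b a -> inI T a b b -> cont_on T a b g ->
  forall c d, ex_RInt (fun x => g (tfloor T a b x)) c d.
Proof.
  intros HT Ia Ib Hg.
  assert (Hab : a <= b) by apply Ib.
  assert (H : ex_RInt (fun x => g (tfloor T a b x)) a b).
  { apply ex_RInt_uniform_approx; [assumption|]. intros eps He.
    set (P := fun t => exists h, ex_RInt h a t /\
      forall x, a < x < t -> Rabs (h x - g (tfloor T a b x)) <= eps).
    (* Appends one constant piece on [(s, t)]; at the joint [s] the approximant takes the exact
       value. *)
    assert (Hglue : forall s t c, inI T a b s -> s <= t -> P s ->
      (forall x, s < x < t -> Rabs (c - g (tfloor T a b x)) <= eps) -> P t).
    { intros s t c [_ Is] Hst [h [Hi Hh]] Hc.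
      exists (fun x => if Rlt_dec x s then h x else if Rlt_dec s x then c
        else g (tfloor T a b x)). split.
      - apply ex_RInt_Chasles with s.
        + apply (ex_RInt_ext h); [|assumption]. intros x Hx.
          rewrite Rmin_left, Rmax_right in Hx by lra.
          destruct (Rlt_dec x s); [reflexivity|lra].
        + apply (ex_RInt_ext (fun _ => c)); [|apply ex_RInt_const]. intros x Hx.
          rewrite Rmin_left, Rmax_right in Hx by lra.
          destruct (Rlt_dec x s); [lra|]. destruct (Rlt_dec s x); [reflexivity|lra].
      - intros x Hx. destruct (Rlt_dec x s); [apply Hh; lra|].
        destruct (Rlt_dec s x); [apply Hc; lra|].
        rewrite Rminus_diag, Rabs_R0. lra. }
    apply (time_scale_induction T a b P HT Ia); [| | | |assumption].
    - exists (fun _ => 0). split; [apply ex_RInt_point|]. intros x Hx. lra.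
    - intros t It Ht _ Pt. apply (Hglue t _ (g t)); try assumption; [lra|].
      intros x Hx. assert (Hr : Rabs (tfloor T a b x - t) <= Rabs (t - t)).
      { apply tfloor_near; try assumption; [apply It|].
        rewrite Rmin_left, Rmax_right; lra. }
      rewrite Rminus_diag, Rabs_R0 in Hr.
      replace (tfloor T a b x) with t by (apply Rabs_le_between in Hr; lra).
      rewrite Rminus_diag, Rabs_R0. lra.
    - intros t It Ht Pt. destruct (Hg t It eps He) as [d [Hd Hc]].
      exists d. split; [assumption|]. intros s Is Hs.
      apply (Hglue t _ (g t)); try assumption; [lra|].
      intros x Hx. rewrite Rabs_minus_sym. left.
      apply Hc; [now apply tfloor_spec|].
      apply Rle_lt_trans with (Rabs (s - t)); [|apply Rabs_def1; lra].
      apply tfloor_near; try assumption; [apply Is|].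
      rewrite Ht, Rmin_right, Rmax_left; lra.
    - intros t It Hdense H. destruct (Hg t It eps He) as [d [Hd Hc]].
      destruct (Hdense d Hd) as [s [Is Hs]].
      apply (Hglue s _ (g t)); try assumption; [lra|apply H; [assumption|lra]|].
      intros x Hx. rewrite Rabs_minus_sym. left.
      apply Hc; [now apply tfloor_spec|].
      apply Rle_lt_trans with (Rabs (s - t)); [|apply Rabs_def1; lra].
      pose proof (tsigma_ge T t).
      apply tfloor_near; try assumption; [apply Is|].
      rewrite Rmin_left, Rmax_right; lra. }
  (* The delta derivative at points of [[a,b]_T] tests all nearby points of [T], and [tsigma T b]
     may exceed [b]. Outside [[a,b]] the integrand is constant. *)
  assert (Hx : forall x, ex_RInt (fun x => g (tfloor T a b x)) a x).
  { assert (Hleft : forall x, x <= a -> ex_RInt (fun x => g (tfloor T a b x)) a x).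
    { intros x Hx. apply (ex_RInt_ext (fun _ => g a)); [|apply ex_RInt_const].
      intros y Hy. rewrite Rmin_right, Rmax_left in Hy by assumption.
      destruct (tfloor_spec T a b y HT Ia) as [[_ Hf] [Hf' _]].
      rewrite Rmax_left in Hf' by lra. f_equal. lra. }
    assert (Hright : forall x, b <= x -> ex_RInt (fun x => g (tfloor T a b x)) a x).
    { intros x Hx. apply ex_RInt_Chasles with b; [assumption|].
      apply (ex_RInt_ext (fun _ => g b)); [|apply ex_RInt_const].
      intros y Hy. rewrite Rmin_left, Rmax_right in Hy by assumption.
      destruct (tfloor_spec T a b y HT Ia) as [[_ Hf] [_ Hf']].
      specialize (Hf' b Ib). rewrite Rmax_right in Hf' by lra. f_equal. lra. }
    intro x. destruct (Rle_dec x a); [auto|]. destruct (Rle_dec b x); [auto|].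
    apply (ex_RInt_Chasles_1 (V := R_CompleteNormedModule) _ a x b); [lra|assumption]. }
  intros c d. apply ex_RInt_Chasles with a; [apply ex_RInt_swap|]; auto.
Qed.

(** Both orientations are covered because [s] may lie on either side of [tsigma T t]; a swap changes
    the sign of both terms. *)
Lemma RInt_near_const (h : R -> R) (s r c eps : R) :
  ex_RInt h s r ->
  (forall x, Rmin s r < x < Rmax s r -> Rabs (h x - c) <= eps) ->
  Rabs (RInt h s r - c * (r - s)) <= eps * Rabs (r - s).
Proof.
  assert (Main : forall s r, s <= r -> ex_RInt h s r ->
    (forall x, s < x < r -> Rabs (h x - c) <= eps) ->
    Rabs (RInt h s r - c * (r - s)) <= eps * (r - s)).
  { clear s r. intros s r Hsr Hi H. apply Rabs_le_between.
    assert (HL : RInt (fun _ => c - eps) s r <= RInt h s r).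
    { apply RInt_le; [assumption|apply ex_RInt_const|assumption|].
      intros x Hx. specialize (H x Hx). apply Rabs_le_between in H. lra. }
    assert (HU : RInt h s r <= RInt (fun _ => c + eps) s r).
    { apply RInt_le; [assumption|assumption|apply ex_RInt_const|].
      intros x Hx. specialize (H x Hx). apply Rabs_le_between in H. lra. }
    rewrite RInt_const in HL, HU. unfold scal in HL, HU; simpl in HL, HU.
    unfold mult in HL, HU; simpl in HL, HU. lra. }
  intros Hi H. destruct (Rle_dec s r) as [Hsr|Hsr].
  - rewrite Rmin_left, Rmax_right in H by assumption.
    rewrite (Rabs_pos_eq (r - s)) by lra. now apply Main.
  - rewrite Rmin_right, Rmax_left in H by lra.
    rewrite <- opp_RInt_swap by now apply ex_RInt_swap.
    rewrite (Rabs_left (r - s)) by lra.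
    replace (opp (RInt h r s) - c * (r - s)) with (- (RInt h r s - c * (s - r)))
      by (unfold opp; simpl; ring).
    rewrite Rabs_Ropp. replace (- (r - s)) with (s - r) by ring.
    apply Main; [lra|now apply ex_RInt_swap|assumption].
Qed.

Definition delta_primitive (T : R -> Prop) (a b : R) (g : R -> R) (t : R) : R :=
  RInt (fun x => g (tfloor T a b x)) a t.

Lemma delta_primitive_start (T : R -> Prop) (a b : R) (g : R -> R) :
  delta_primitive T a b g a = 0.
Proof. apply (RInt_point (V := R_CompleteNormedModule)). Qed.

(** The increment from [s] to [tsigma T t] is an integral over that very interval, where [tfloor]
    stays within [|s - t|] of [t]. Continuity of [g] at [t] then gives the required error for
    scattered and dense [t] alike. *)
Lemma delta_primitive_deriv (T : R -> Prop) (a b : R) (g : R -> R) :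
  closedR T -> inI T a b a -> inI T a b b -> cont_on T a b g ->
  forall t, inI T a b t -> delta_deriv T (delta_primitive T a b g) t (g t).
Proof.
  intros HT Ia Ib Hg t It eps He. destruct (Hg t It eps He) as [d [Hd Hc]].
  exists d. split; [assumption|]. intros s Ts Hs.
  pose proof (ex_RInt_tfloor T a b g HT Ia Ib Hg) as Hi.
  unfold delta_primitive.
  rewrite <- (RInt_Chasles (fun x => g (tfloor T a b x)) a s (tsigma T t)) by apply Hi.
  assert (Hplus : forall u v : R, plus u v - u = v) by (intros; unfold plus; simpl; ring).
  rewrite Hplus.
  apply RInt_near_const; [apply Hi|].
  intros x Hx. left. apply Hc; [now apply tfloor_spec|].
  eapply Rle_lt_trans; [|exact Hs]. now apply tfloor_near.
Qed.

(** * Geometric convergence and the contraction estimate *)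

(** The induction on [k] needs the sharper bound with the remaining tail [2 C (1/2)^(n+k)]
    subtracted. *)
Lemma geometric_steps_dist (x : nat -> R) (C : R) :
  0 <= C -> (forall n, Rabs (x (S n) - x n) <= C * (/ 2) ^ n) ->
  forall n k, Rabs (x (n + k)%nat - x n) <= 2 * C * (/ 2) ^ n.
Proof.
  intros HC H n k.
  assert (Hp : forall m, 0 < (/ 2) ^ m) by (intro; apply pow_lt; lra).
  assert (Rabs (x (n + k)%nat - x n) <= 2 * C * (/ 2) ^ n - 2 * C * (/ 2) ^ (n + k)).
  { induction k as [|k IH].
    - rewrite Nat.add_0_r, !Rminus_diag, Rabs_R0. lra.
    - specialize (H (n + k)%nat). rewrite Nat.add_succ_r. simpl.
      replace (x (S (n + k)) - x n) with ((x (S (n + k)) - x (n + k)%nat) + (x (n + k)%nat - x n)) by ring.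
      eapply Rle_trans; [apply Rabs_triang|]. lra. }
  assert (0 <= 2 * C * (/ 2) ^ (n + k)); [|lra].
  apply Rmult_le_pos; [lra|left; apply Hp].
Qed.

Lemma geometric_eventually_small (C eps : R) :
  0 <= C -> 0 < eps -> exists n, C * (/ 2) ^ n < eps.
Proof.
  intros HC He.
  destruct (pow_lt_1_zero (/ 2)) with (y := eps / (C + 1)) as [n Hn].
  - rewrite Rabs_pos_eq; lra.
  - apply Rdiv_lt_0_compat; lra.
  - exists n. specialize (Hn n (Nat.le_refl n)).
    assert (Hp : 0 < (/ 2) ^ n) by (apply pow_lt; lra).
    rewrite Rabs_pos_eq in Hn by lra.
    apply Rlt_le_trans with ((C + 1) * (eps / (C + 1))); [|right; field; lra].
    apply Rle_lt_trans with ((C + 1) * (/ 2) ^ n); [|apply Rmult_lt_compat_l; lra].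
    apply Rmult_le_compat_r; lra.
Qed.

(** The Cauchy criterion shows that [Lim_seq x] is a true finite limit and not a default value; the
    distance bound then passes to the limit in [k]. *)
Lemma geometric_steps_limit (x : nat -> R) (C : R) :
  0 <= C -> (forall n, Rabs (x (S n) - x n) <= C * (/ 2) ^ n) ->
  forall n, Rabs (Lim_seq x - x n) <= 2 * C * (/ 2) ^ n.
Proof.
  intros HC H. pose proof (geometric_steps_dist x C HC H) as Hd.
  assert (Hl : is_lim_seq x (real (Lim_seq x))).
  { apply Lim_seq_correct', ex_lim_seq_cauchy_corr. intros eps.
    destruct (geometric_eventually_small (2 * C) (eps / 2)) as [N HN].
    - lra.
    - destruct eps; simpl; lra.
    - exists N. intros n m Hn Hm.
      pose proof (Hd N (n - N)%nat) as H1. pose proof (Hd N (m - N)%nat) as H2.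
      replace (N + (n - N))%nat with n in H1 by lia.
      replace (N + (m - N))%nat with m in H2 by lia.
      replace (x n - x m) with ((x n - x N) - (x m - x N)) by ring.
      eapply Rle_lt_trans; [apply Rabs_triang|]. rewrite Rabs_Ropp. lra. }
  intro n. apply (is_lim_seq_le (fun k => Rabs (x (k + n)%nat - x n)) (fun _ => 2 * C * (/ 2) ^ n)
    (Finite _) (Finite _)).
  - intro k. rewrite Nat.add_comm. apply Hd.
  - apply (is_lim_seq_abs _ (Finite _)). apply is_lim_seq_minus'.
    + now apply is_lim_seq_incr_n.
    + apply is_lim_seq_const.
  - apply is_lim_seq_const.
Qed.

(* Since [lam = 2 (P + Q) + 1 >= 1], each integration divides the weighted sup norm by [lam]. *)
Lemma lower_order_contraction (T : R -> Prop) (a b P Q N : R) (p q W W1 V : R -> R) :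
  let lam := 2 * (P + Q) + 1 in
  closedR T -> inI T a b a -> 0 <= P -> 0 <= Q -> 0 <= N ->
  (forall t, inI T a b t -> Rabs (p t) <= P) ->
  (forall t, inI T a b t -> Rabs (q t) <= Q) ->
  W a = 0 -> W1 a = 0 ->
  (forall t, inI T a b t -> delta_deriv T W t (W1 t)) ->
  (forall t, inI T a b t -> delta_deriv T W1 t (V t)) ->
  (forall t, inI T a b t -> Rabs (V t) <= N * weight lam a t) ->
  forall t, inI T a b t ->
    Rabs (p t * W1 t + q t * W t) <= N / 2 * weight lam a t /\
    Rabs (W t) <= N * weight lam a t.
Proof.
  intros lam HT Ia HP HQ HN Hp Hq W0 W10 HW HW1 HV t It.
  assert (Hlam : 1 <= lam) by (unfold lam; lra).
  pose proof (delta_growth T a b lam N W1 V HT Ia ltac:(lra) HN W10 HW1 HV) as B1.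
  assert (HNl : 0 <= N / lam) by (apply Rdiv_le_0_compat; lra).
  pose proof (delta_growth T a b lam (N / lam) W W1 HT Ia ltac:(lra) HNl W0 HW B1 t It) as B0.
  specialize (B1 t It). pose proof (weight_pos lam a t) as Hw.
  set (w := weight lam a t) in *.
  assert (Hd : forall x, 0 <= x -> x / lam <= x).
  { intros x Hx. apply (Rmult_le_reg_r lam); [lra|].
    replace (x / lam * lam) with x by (field; lra). nra. }
  assert (B0' : Rabs (W t) <= N / lam * w).
  { eapply Rle_trans; [exact B0|]. apply Rmult_le_compat_r; [lra|auto]. }
  split.
  - apply Rle_trans with (P * (N / lam * w) + Q * (N / lam * w)).
    + eapply Rle_trans; [apply Rabs_triang|]. rewrite !Rabs_mult.
      apply Rplus_le_compat; apply Rmult_le_compat; auto using Rabs_pos.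
    + rewrite <- Rmult_plus_distr_r, <- Rmult_assoc.
      apply Rmult_le_compat_r; [lra|]. apply (Rmult_le_reg_r lam); [lra|].
      replace ((P + Q) * (N / lam) * lam) with ((P + Q) * N) by (field; lra).
      unfold lam. lra.
  - eapply Rle_trans; [exact B0'|]. apply Rmult_le_compat_r; [lra|auto].
Qed.

(** * Continuous functions on [[a,b]_T] *)

(** The filter form gives access to the limit theorems for sums, products and opposites. *)
Lemma cont_at_on_continuous (T : R -> Prop) (a b : R) (g : R -> R) (t : R) :
  cont_at_on T a b g t <-> filterlim g (within (inI T a b) (locally t)) (locally (g t)).
Proof.
  split.
  - intros H. apply filterlim_locally. intro eps.
    destruct (H eps (cond_pos eps)) as [d [Hd K]].
    exists (mkposreal d Hd). intros s Hs Is. now apply K.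
  - intros H eps He.
    pose proof (proj1 (filterlim_locally _ _) H (mkposreal eps He)) as [d K].
    exists d. split; [apply cond_pos|]. intros s Is Hs. now apply K.
Qed.

Lemma cont_on_plus (T : R -> Prop) (a b : R) (g h : R -> R) :
  cont_on T a b g -> cont_on T a b h -> cont_on T a b (fun t => g t + h t).
Proof.
  intros Hg Hh t It. apply cont_at_on_continuous.
  eapply filterlim_comp_2.
  - apply cont_at_on_continuous, Hg, It.
  - apply cont_at_on_continuous, Hh, It.
  - apply (filterlim_plus (V := R_NormedModule)).
Qed.

Lemma cont_on_mult (T : R -> Prop) (a b : R) (g h : R -> R) :
  cont_on T a b g -> cont_on T a b h -> cont_on T a b (fun t => g t * h t).
Proof.
  intros Hg Hh t It. apply cont_at_on_continuous.
  eapply filterlim_comp_2.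
  - apply cont_at_on_continuous, Hg, It.
  - apply cont_at_on_continuous, Hh, It.
  - apply (filterlim_mult (K := R_AbsRing)).
Qed.

Lemma cont_on_opp (T : R -> Prop) (a b : R) (g : R -> R) :
  cont_on T a b g -> cont_on T a b (fun t => - g t).
Proof.
  intros Hg t It. apply cont_at_on_continuous.
  eapply filterlim_comp.
  - apply cont_at_on_continuous, Hg, It.
  - apply (filterlim_opp (V := R_NormedModule)).
Qed.

Lemma cont_on_const (T : R -> Prop) (a b c : R) : cont_on T a b (fun _ => c).
Proof.
  intros t It. apply cont_at_on_continuous, filterlim_const.
Qed.

Lemma cont_on_uniform_approx (T : R -> Prop) (a b : R) (g : R -> R) :
  (forall eps, 0 < eps -> exists h, cont_on T a b h /\
     forall t, inI T a b t -> Rabs (g t - h t) < eps) ->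
  cont_on T a b g.
Proof.
  intros H t It eps He. destruct (H (eps / 3)) as [h [Hc Hh]]; [lra|].
  destruct (Hc t It (eps / 3)) as [d [Hd K]]; [lra|].
  exists d. split; [assumption|]. intros s Is Hs.
  pose proof (Hh t It) as H1. pose proof (Hh s Is) as H2. pose proof (K s Is Hs) as H3.
  apply Rabs_def2 in H1, H2, H3. apply Rabs_def1; lra.
Qed.

Lemma cont_on_rd_cont_on (T : R -> Prop) (a b : R) (g : R -> R) :
  cont_on T a b g -> rd_cont_on T a b g.
Proof.
  intros H. split; [auto|]. intros t It _ _. exists (g t). intros eps He.
  destruct (H t It eps He) as [d [Hd K]]. exists d. split; [assumption|].
  intros s Is H1 H2. apply K; [assumption|apply Rabs_def1; lra].
Qed.

(** * The initial value problem and the stability estimate *)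

Lemma second_order_ivp (T : R -> Prop) (a b : R) (p q f : R -> R) (c0 c1 : R) :
  closedR T -> inI T a b a -> inI T a b b ->
  cont_on T a b p -> cont_on T a b q -> cont_on T a b f ->
  exists u u1 u2 : R -> R,
    u a = c0 /\ u1 a = c1 /\
    (forall t, inI T a b t -> delta_deriv T u t (u1 t)) /\
    (forall t, inI T a b t -> delta_deriv T u1 t (u2 t)) /\
    cont_on T a b u2 /\
    (forall t, inI T a b t -> u2 t + p t * u1 t + q t * u t = f t).
Proof.
  intros HT Ia Ib Hp Hq Hf.
  destruct (cont_on_bounded T a b p HT Ia Ib Hp) as [P [HP HPb]].
  destruct (cont_on_bounded T a b q HT Ia Ib Hq) as [Q [HQ HQb]].
  set (lam := 2 * (P + Q) + 1).
  assert (Hlam : 1 <= lam) by (unfold lam; lra).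
  (* The second derivative [v] is the unknown: [U1 v] and [U v] are its iterated
     primitives, and [v] is a fixed point of [Phi]. *)
  set (U1 := fun v t => c1 + 1 * delta_primitive T a b v t).
  set (U := fun v t => c0 + 1 * delta_primitive T a b (U1 v) t).
  set (Phi := fun v t => f t + - (p t * U1 v t + q t * U v t)).
  assert (HU1 : forall v, cont_on T a b v ->
    forall t, inI T a b t -> delta_deriv T (U1 v) t (v t)).
  { intros v Hv t It. replace (v t) with (0 + 1 * v t) by ring.
    apply delta_deriv_lincomb; [apply delta_deriv_const|now apply delta_primitive_deriv]. }
  assert (HU : forall v, cont_on T a b v ->
    forall t, inI T a b t -> delta_deriv T (U v) t (U1 v t)).
  { intros v Hv t It. replace (U1 v t) with (0 + 1 * U1 v t) by ring.
    apply delta_deriv_lincomb; [apply delta_deriv_const|].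
    apply delta_primitive_deriv; try assumption.
    apply (delta_deriv_cont_on T a b _ v). auto. }
  assert (HPhi : forall v, cont_on T a b v -> cont_on T a b (Phi v)).
  { intros v Hv. apply cont_on_plus; [assumption|]. apply cont_on_opp, cont_on_plus.
    - apply cont_on_mult; [assumption|]. apply (delta_deriv_cont_on T a b _ v). auto.
    - apply cont_on_mult; [assumption|]. apply (delta_deriv_cont_on T a b _ (U1 v)). auto. }
  (* In the difference of two images [f] and the initial constants cancel, so both primitives of
     [v - w] start from 0. *)
  assert (Hctr : forall v w N, cont_on T a b v -> cont_on T a b w -> 0 <= N ->
    (forall t, inI T a b t -> Rabs (v t - w t) <= N * weight lam a t) ->
    forall t, inI T a b t -> Rabs (Phi v t - Phi w t) <= N / 2 * weight lam a t).
  { intros v w N Hv Hw HN H t It.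
    replace (Phi v t - Phi w t)
      with (- (p t * (U1 v t - U1 w t) + q t * (U v t - U w t))) by (unfold Phi; ring).
    rewrite Rabs_Ropp.
    apply (lower_order_contraction T a b P Q N p q (fun t => U v t - U w t)
      (fun t => U1 v t - U1 w t) (fun t => v t - w t)); try assumption.
    - unfold U. rewrite !delta_primitive_start. ring.
    - unfold U1. rewrite !delta_primitive_start. ring.
    - intros s Is. apply delta_deriv_minus; auto.
    - intros s Is. apply delta_deriv_minus; auto. }
  set (v := fun n : nat => Nat.iter n Phi (fun _ => 0)).
  assert (Hv : forall n, cont_on T a b (v n)).
  { induction n as [|n IH]; [apply cont_on_const|now apply HPhi]. }
  destruct (cont_on_bounded T a b (v 1%nat) HT Ia Ib (Hv 1%nat)) as [C [HC HCb]].
  assert (Hw1 : forall t, inI T a b t -> 1 <= weight lam a t).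
  { intros t [_ It]. apply weight_ge_1; lra. }
  assert (Hpow : forall n, 0 < (/ 2) ^ n) by (intro; apply pow_lt; lra).
  assert (Hstep : forall n t, inI T a b t ->
    Rabs (v (S n) t - v n t) <= C * (/ 2) ^ n * weight lam a t).
  { induction n as [|n IH].
    - intros t It. replace (v 1%nat t - v 0%nat t) with (v 1%nat t) by (unfold v at 3; simpl; ring).
      specialize (HCb t It). specialize (Hw1 t It). rewrite pow_O, Rmult_1_r.
      assert (C * 1 <= C * weight lam a t) by (apply Rmult_le_compat_l; assumption). lra.
    - intros t It.
      replace (C * (/ 2) ^ S n) with (C * (/ 2) ^ n / 2) by (simpl; field).
      apply (Hctr (v (S n)) (v n)); auto.
      apply Rmult_le_pos; [assumption|left; apply Hpow]. }
  set (l := fun t => real (Lim_seq (fun n => v n t))).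
  assert (Hl : forall n t, inI T a b t ->
    Rabs (l t - v n t) <= 2 * C * (/ 2) ^ n * weight lam a t).
  { intros n t It. specialize (Hw1 t It).
    replace (2 * C * (/ 2) ^ n * weight lam a t)
      with (2 * (C * weight lam a t) * (/ 2) ^ n) by ring.
    apply (geometric_steps_limit (fun n => v n t)).
    - apply Rmult_le_pos; lra.
    - intro k. replace (C * weight lam a t * (/ 2) ^ k)
        with (C * (/ 2) ^ k * weight lam a t) by ring. now apply Hstep. }
  assert (Hwb : forall t, inI T a b t -> weight lam a t <= weight lam a b).
  { intros t [_ It]. apply weight_le; lra. }
  pose proof (weight_pos lam a b) as Hb.
  assert (HCb2 : 0 <= 2 * C * weight lam a b) by (apply Rmult_le_pos; lra).
  (* Bounding the weight by its value at [b] makes the convergence uniform. Continuity of [l] is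
     what makes its primitives delta differentiable. *)
  assert (Hlc : cont_on T a b l).
  { apply cont_on_uniform_approx. intros eps He.
    destruct (geometric_eventually_small (2 * C * weight lam a b) eps HCb2 He) as [n Hn].
    exists (v n). split; [apply Hv|]. intros t It.
    eapply Rle_lt_trans; [now apply Hl|]. eapply Rle_lt_trans; [|exact Hn].
    replace (2 * C * weight lam a b * (/ 2) ^ n) with (2 * C * (/ 2) ^ n * weight lam a b) by ring.
    apply Rmult_le_compat_l; [|now apply Hwb].
    apply Rmult_le_pos; [lra|left; apply Hpow]. }
  (* [l - Phi l] splits into [l - v (S n)] and [Phi l - Phi (v n)], each at most [C (1/2)^n] times
     the weight. *)
  assert (Hfix : forall t, inI T a b t -> l t = Phi l t).
  { intros t It. apply cond_eq. intros eps He.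
    destruct (geometric_eventually_small (2 * C * weight lam a b) eps HCb2 He) as [n Hn].
    assert (H0 : 0 <= 2 * C * (/ 2) ^ n)
      by (apply Rmult_le_pos; [lra|left; apply Hpow]).
    pose proof (Hctr l (v n) _ Hlc (Hv n) H0 (Hl n) t It) as H1.
    pose proof (Hl (S n) t It) as H2.
    replace (2 * C * (/ 2) ^ S n) with (2 * C * (/ 2) ^ n / 2) in H2 by (simpl; field).
    replace (l t - Phi l t) with ((l t - v (S n) t) - (Phi l t - Phi (v n) t))
      by (simpl; ring).
    eapply Rle_lt_trans; [apply Rabs_triang|]. rewrite Rabs_Ropp.
    assert (2 * C * (/ 2) ^ n * weight lam a t <= 2 * C * (/ 2) ^ n * weight lam a b)
      by (apply Rmult_le_compat_l; [assumption|now apply Hwb]).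
    lra. }
  exists (U l), (U1 l), l.
  split; [unfold U; rewrite delta_primitive_start; ring|].
  split; [unfold U1; rewrite delta_primitive_start; ring|].
  split; [auto|]. split; [auto|]. split; [assumption|].
  intros t It. rewrite (Hfix t It) at 1. unfold Phi. ring.
Qed.

(** The residual bounds [|V|] by [eps] plus the lower-order terms, so a weighted bound [N] on [V]
    improves to [eps + N / 2]. This map has fixed point [2 eps]; started at [2 eps + C] it yields
    [2 eps + C (1/2)^n]. The bound on [V] carries over to [W], and [n] goes to infinity. *)
Lemma second_order_stability (T : R -> Prop) (a b P Q eps : R) (p q W W1 V : R -> R) :
  let lam := 2 * (P + Q) + 1 in
  closedR T -> inI T a b a -> inI T a b b -> 0 <= P -> 0 <= Q -> 0 <= eps ->
  (forall t, inI T a b t -> Rabs (p t) <= P) ->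
  (forall t, inI T a b t -> Rabs (q t) <= Q) ->
  W a = 0 -> W1 a = 0 ->
  (forall t, inI T a b t -> delta_deriv T W t (W1 t)) ->
  (forall t, inI T a b t -> delta_deriv T W1 t (V t)) ->
  (forall t, inI T a b t -> Rabs (V t + p t * W1 t + q t * W t) <= eps) ->
  forall t, inI T a b t -> Rabs (W t) <= 2 * eps * weight lam a t.
Proof.
  intros lam HT Ia Ib HP HQ He Hp Hq W0 W10 HW HW1 HV.
  assert (Hlam : 1 <= lam) by (unfold lam; lra).
  assert (Hw1 : forall t, inI T a b t -> 1 <= weight lam a t).
  { intros t [_ It]. apply weight_ge_1; lra. }
  assert (Hpow : forall n, 0 < (/ 2) ^ n) by (intro; apply pow_lt; lra).
  (* An a priori bound on [V], needed to start the contraction. *)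
  destruct (cont_on_bounded T a b W1 HT Ia Ib) as [M1 [HM1 HM1b]].
  { now apply (delta_deriv_cont_on T a b _ V). }
  destruct (cont_on_bounded T a b W HT Ia Ib) as [M0 [HM0 HM0b]].
  { now apply (delta_deriv_cont_on T a b _ W1). }
  set (C := P * M1 + Q * M0).
  assert (HC : 0 <= C) by (apply Rplus_le_le_0_compat; now apply Rmult_le_pos).
  assert (Hbound : forall n t, inI T a b t ->
    Rabs (V t) <= (2 * eps + C * (/ 2) ^ n) * weight lam a t).
  { assert (Hsplit : forall t, inI T a b t ->
      Rabs (V t) <= eps + Rabs (p t * W1 t + q t * W t)).
    { intros t It. specialize (HV t It).
      replace (V t) with ((V t + p t * W1 t + q t * W t) + - (p t * W1 t + q t * W t)) by ring.
      eapply Rle_trans; [apply Rabs_triang|]. rewrite Rabs_Ropp. lra. }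
    induction n as [|n IH]; intros t It;
      specialize (Hsplit t It); specialize (Hw1 t It).
    - apply Rle_trans with (eps + C).
      + eapply Rle_trans; [exact Hsplit|]. apply Rplus_le_compat_l.
        eapply Rle_trans; [apply Rabs_triang|]. rewrite !Rabs_mult.
        apply Rplus_le_compat; apply Rmult_le_compat; auto using Rabs_pos.
      + simpl. assert (0 <= (2 * eps + C) * (weight lam a t - 1)) by (apply Rmult_le_pos; lra).
        lra.
    - assert (HN : 0 <= 2 * eps + C * (/ 2) ^ n).
      { pose proof (Hpow n). assert (0 <= C * (/ 2) ^ n) by (apply Rmult_le_pos; lra). lra. }
      destruct (lower_order_contraction T a b P Q _ p q W W1 V HT Ia HP HQ HN Hp Hq
        W0 W10 HW HW1 IH t It) as [H _]. fold lam in H.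
      assert (eps * 1 <= eps * weight lam a t) by (apply Rmult_le_compat_l; assumption).
      simpl. lra. }
  intros t It. apply le_epsilon. intros e He'.
  pose proof (Hw1 t It) as Hwt.
  destruct (geometric_eventually_small (C * weight lam a t) e) as [n Hn];
    [apply Rmult_le_pos; lra|assumption|].
  assert (HN : 0 <= 2 * eps + C * (/ 2) ^ n).
  { pose proof (Hpow n). assert (0 <= C * (/ 2) ^ n) by (apply Rmult_le_pos; lra). lra. }
  destruct (lower_order_contraction T a b P Q _ p q W W1 V HT Ia HP HQ HN Hp Hq
    W0 W10 HW HW1 (Hbound n) t It) as [_ H]. fold lam in H. lra.
Qed.

Theorem mainTheorem3
  (T : R -> Prop) (HTclosed : closedR T) (HTne : exists t, T t)
  (a b : R) (Ta : T a) (Tb : T b) (hab : a < b)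
  (p q f : R -> R)
  (hp : cont_on T a b p) (hq : cont_on T a b q) (hf : cont_on T a b f)
  (z z1 : R -> R)
  (hz : forall t, inI T a b t -> delta_deriv T z t (z1 t))
  (hric : forall t, inI T a b t ->
     z1 t + p t * z t - z t * z (tsigma T t) = q t)
  (hreg1 : forall t, inI T a b t -> 1 + tmu T t * (z (tsigma T t) - p t) <> 0)
  (hreg2 : forall t, inI T a b t -> 1 - tmu T t * z t <> 0)
  (hsup1 : exists M, forall t, inI T a b t -> exists I,
     delta_integral T
       (fun s => Rabs (texp T a b (fun w => z (tsigma T w) - p w) a (tsigma T s))) a t I /\
     Rabs (texp T a b (fun w => z (tsigma T w) - p w) t a) * I <= M)
  (hsup2 : exists M, forall t, inI T a b t -> exists I,
     delta_integral T
       (fun s => Rabs (texp T a b (fun w => - z w) a (tsigma T s))) a t I /\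
     Rabs (texp T a b (fun w => - z w) t a) * I <= M) :
  exists K, 0 < K /\
    forall eps, 0 < eps ->
    forall y y1 y2 : R -> R, C2rd T a b y y1 y2 ->
      (forall t, inI T a b t -> Rabs (y2 t + p t * y1 t + q t * y t - f t) <= eps) ->
      exists u u1 u2 : R -> R, C2rd T a b u u1 u2 /\
        (forall t, inI T a b t -> u2 t + p t * u1 t + q t * u t = f t) /\
        (forall t, inI T a b t -> Rabs (y t - u t) <= K * eps).
Proof.
  assert (Ia : inI T a b a) by (split; [assumption|lra]).
  assert (Ib : inI T a b b) by (split; [assumption|lra]).
  destruct (cont_on_bounded T a b p HTclosed Ia Ib hp) as [P [HP HPb]].
  destruct (cont_on_bounded T a b q HTclosed Ia Ib hq) as [Q [HQ HQb]].
  set (lam := 2 * (P + Q) + 1).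
  (* [lam] depends only on bounds for [p] and [q], so this constant is fixed before [eps] and
     [y]. *)
  exists (2 * weight lam a b).
  pose proof (weight_pos lam a b) as Hw. split; [lra|].
  intros eps He y y1 y2 [Hy [Hy1 _]] Hres.
  destruct (second_order_ivp T a b p q f (y a) (y1 a) HTclosed Ia Ib hp hq hf)
    as [u [u1 [u2 [Hu0 [Hu10 [Hu [Hu1 [Hu2 Heq]]]]]]]].
  exists u, u1, u2. split.
  { split; [assumption|]. split; [assumption|now apply cont_on_rd_cont_on]. }
  split; [assumption|]. intros t It.
  apply Rle_trans with (2 * eps * weight lam a t).
  - apply (second_order_stability T a b P Q eps p q (fun s => y s - u s)
      (fun s => y1 s - u1 s) (fun s => y2 s - u2 s)); try assumption; try lra.
    + intros s Is. apply delta_deriv_minus; auto.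
    + intros s Is. apply delta_deriv_minus; auto.
    (* The equation for [u] eliminates [f]: the homogeneous expression in [y - u] is the residual of
       [y]. *)
    + intros s Is. eapply Rle_trans; [|exact (Hres s Is)]. right. f_equal.
      rewrite <- (Heq s Is). ring.
  - assert (weight lam a t <= weight lam a b).
    { destruct It. apply weight_le; unfold lam; lra. }
    assert (eps * weight lam a t <= eps * weight lam a b)
      by (apply Rmult_le_compat_l; lra). lra.
Qed.
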